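(* Let $E,H\in\mathcal A$ and fix $F=-D=1-S$. Then $(E,H,F)$ is an $\mathfrak{sl}_2$-triple if and only if there exist unique $\lambda\in\mathbb K$ and $g(D)\in R$ such that, with $Y=X+g(D)$, one has $$H=2YD-\lambda,\qquad E=Y^2D-\lambda Y.$$ Moreover, for every $g\in R$, the assignment $$\sigma_g(D)=D,\qquad \sigma_g(X)=X+g(D)$$ defines a $\mathbb K$-algebra automorphism $\sigma_g$ of $\mathcal A$ with inverse $\sigma_{-g}$. If $$H^{(0)}_\lambda=2XD-\lambda,\qquad E^{(0)}_\lambda=X^2D-\lambda X,$$ then every $\mathfrak{sl}_2$-triple $(E,H,F)$ in $\mathcal A$ with $F=-D$ is, for a unique pair $(g,\lambda)\in R\times\mathbb K$, equal to $$(E,H,F)=\bigl(\sigma_g(E^{(0)}_\lambda),\ \sigma_g(H^{(0)}_\lambda),\ -D\bigr).$$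
   Context: $\mathbb K$ is a field of characteristic zero. $\mathcal A=\mathbb K[x]\langle S,S^{-1}\rangle/(Sx-(x+1)S)$ is the algebra of finite Laurent-shift operators: its elements are finite sums $\sum_j t_j(x)S^j$ with $j\in\mathbb Z$, $t_j(x)\in\mathbb K[x]$, and $Sx=(x+1)S$. Set $D=S-1$, $X=xS^{-1}$, and $R=\mathbb K[D,(D+1)^{-1}]=\mathbb K[S,S^{-1}]\subset\mathcal A$ (where $S=1+D$). An $\mathfrak{sl}_2$-triple $(E,H,F)$ in $\mathcal A$ is a triple of elements satisfying $[H,E]=2E$, $[H,F]=-2F$, $[E,F]=H$. *)

(* Defs.v *)
From HB Require Import structures.
From mathcomp Require Import all_boot all_order all_algebra.
From mathcomp Require Import finmap.
From mathcomp.multinomials Require Import monalg.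

Set Implicit Arguments.
Unset Strict Implicit.
Unset Printing Implicit Defensive.

Import GRing.Theory.
Local Open Scope ring_scope.

(* The algebra of finite Laurent-shift operators
     A = K[x]<S, S^-1> / (S x - (x + 1) S),
   realised on its normal forms: the finitely supported family t of
   polynomials stands for \sum_j t_j(x) S^j.  Since S^i u(x) = u(x + i) S^i,
   the product is the bilinear extension of
     (t S^i) (u S^j) = t(x) u(x + i) S^(i + j). *)
Definition shiftAlg (K : fieldType) : Type := {malg {poly K}[int]}.

HB.instance Definition _ (K : fieldType) := GRing.Zmodule.on (shiftAlg K).

Section ShiftAlgebra.

Variable K : fieldType.
Local Notation A := (shiftAlg K).

Definition shiftp (i : int) (p : {poly K}) : {poly K} :=
  p \Po ('X + i%:~R%:P).

Definition shiftMon (t : {poly K}) (i : int) : A := << t *g i >>.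

Definition shift_mul (a b : A) : A :=
  \sum_(i <- msupp a) \sum_(j <- msupp b)
     shiftMon (a@_i * shiftp i b@_j) (i + j).

Definition shift_one : A := shiftMon 1 0.

Definition shift_scale (c : K) (a : A) : A :=
  \sum_(i <- msupp a) shiftMon (c%:P * a@_i) i.

Lemma shiftp0 p : shiftp 0 p = p.
Proof. by rewrite /shiftp rmorph0 addr0 comp_polyXr. Qed.

Lemma shiftp_shift i j p : shiftp i (shiftp j p) = shiftp (i + j) p.
Proof.
rewrite /shiftp -comp_polyA comp_polyD comp_polyX comp_polyC.
by rewrite -addrA -rmorphD -rmorphD.
Qed.

Lemma shiftpM i : {morph shiftp i : p q / p * q}.
Proof. by move=> p q; rewrite /shiftp comp_polyM. Qed.

Lemma shiftpD i : {morph shiftp i : p q / p + q}.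
Proof. by move=> p q; rewrite /shiftp comp_polyD. Qed.

Lemma shiftpC i c : shiftp i c%:P = c%:P.
Proof. by rewrite /shiftp comp_polyC. Qed.

Lemma shiftMon0 i : shiftMon 0 i = 0.
Proof. exact: monalgU0. Qed.

Lemma shiftMonD t u i : shiftMon (t + u) i = shiftMon t i + shiftMon u i.
Proof. exact: monalgUD. Qed.

Lemma shift_sum (a : A) : a = \sum_(i <- msupp a) shiftMon a@_i i.
Proof. exact: monalgE. Qed.

Lemma msum_monE (F : int -> {poly K} -> A) t i :
    (forall j, F j 0 = 0) ->
  \sum_(j <- msupp (shiftMon t i)) F j (shiftMon t i)@_j = F i t.
Proof.
move=> F0; rewrite msuppU; case: eqP => [->|_].
  by rewrite big_seq_fset0 F0.
by rewrite big_seq_fset1 mcoeffUU.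
Qed.

Lemma msumD (F : int -> {poly K} -> A) (a b : A) :
    (forall j, F j 0 = 0) -> (forall j p q, F j (p + q) = F j p + F j q) ->
  \sum_(j <- msupp (a + b)) F j (a + b)@_j =
    \sum_(j <- msupp a) F j a@_j + \sum_(j <- msupp b) F j b@_j.
Proof.
move=> F0 FD.
have ext (c : A) (d : {fset int}) : (msupp c `<=` d)%fset ->
    \sum_(j <- msupp c) F j c@_j = \sum_(j <- d) F j c@_j.
  move=> le; apply: big_fset_incl => // j _ /mcoeff_outdom ->; exact: F0.
rewrite (ext _ _ (msuppD_le a b)).
rewrite (ext a _ (fsubsetUl (msupp a) (msupp b))).
rewrite (ext b _ (fsubsetUr (msupp a) (msupp b))) -big_split /=.
by apply: eq_bigr => j _; rewrite mcoeffD FD.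
Qed.

Lemma shift_mulDl : left_distributive shift_mul +%R.
Proof.
move=> a b c; rewrite /shift_mul.
pose F i p := \sum_(j <- msupp c) shiftMon (p * shiftp i c@_j) (i + j).
apply: (msumD (F := F)) => [i|i p q]; rewrite /F.
  by rewrite big1 // => j _; rewrite mul0r shiftMon0.
by rewrite -big_split; apply: eq_bigr => j _; rewrite mulrDl shiftMonD.
Qed.

Lemma shift_mulDr : right_distributive shift_mul +%R.
Proof.
move=> c a b; rewrite /shift_mul -big_split; apply: eq_bigr => i _ /=.
pose F j p := shiftMon (c@_i * shiftp i p) (i + j).
apply: (msumD (F := F)) => [j|j p q]; rewrite /F.
  by rewrite /shiftp comp_poly0 mulr0 shiftMon0.
by rewrite shiftpD mulrDr shiftMonD.
Qed.

Lemma shift_mul_mon t u i j :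
  shift_mul (shiftMon t i) (shiftMon u j) =
    shiftMon (t * shiftp i u) (i + j).
Proof.
rewrite /shift_mul (msum_monE (F := fun i p =>
  \sum_(j0 <- msupp (shiftMon u j))
     shiftMon (p * shiftp i (shiftMon u j)@_j0) (i + j0))); last first.
  by move=> k; rewrite big1 // => l _; rewrite mul0r shiftMon0.
apply: (msum_monE (F := fun j p => shiftMon (t * shiftp i p) (i + j))).
by move=> k; rewrite /shiftp comp_poly0 mulr0 shiftMon0.
Qed.

Lemma shift_ind (P : A -> Prop) :
    P 0 -> (forall t i, P (shiftMon t i)) ->
    (forall a b, P a -> P b -> P (a + b)) ->
  forall a, P a.
Proof. by move=> P0 PM PD a; rewrite (shift_sum a); elim/big_ind: _. Qed.

Lemma shift_mul0l a : shift_mul 0 a = 0.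
Proof. by apply: (addrI (shift_mul 0 a)); rewrite -shift_mulDl !addr0. Qed.

Lemma shift_mul0r a : shift_mul a 0 = 0.
Proof. by apply: (addrI (shift_mul a 0)); rewrite -shift_mulDr !addr0. Qed.

Lemma shift_mulA : associative shift_mul.
Proof.
move=> a b c.
elim/shift_ind: a => [|t i|a a' IHa IHa']; first by rewrite !shift_mul0l.
  elim/shift_ind: b => [|u j|b b' IHb IHb'].
  - by rewrite !(shift_mul0l, shift_mul0r).
  - elim/shift_ind: c => [|v k|c c' IHc IHc'].
    + by rewrite !shift_mul0r.
    + by rewrite !shift_mul_mon shiftpM shiftp_shift mulrA addrA.
    by rewrite !shift_mulDr IHc IHc'.
  by rewrite !(shift_mulDr, shift_mulDl) IHb IHb'.
by rewrite !shift_mulDl IHa IHa'.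
Qed.

Lemma shift_mul1l : left_id shift_one shift_mul.
Proof.
elim/shift_ind=> [|t i|a b IHa IHb]; first exact: shift_mul0r.
  by rewrite shift_mul_mon shiftp0 mul1r add0r.
by rewrite shift_mulDr IHa IHb.
Qed.

Lemma shift_mul1r : right_id shift_one shift_mul.
Proof.
elim/shift_ind=> [|t i|a b IHa IHb]; first exact: shift_mul0l.
  by rewrite shift_mul_mon shiftpC mulr1 addr0.
by rewrite shift_mulDl IHa IHb.
Qed.

Lemma shift_oner_neq0 : shift_one != 0.
Proof. by rewrite monalgU_eq0 oner_eq0. Qed.

HB.instance Definition _ := GRing.Zmodule_isNzRing.Build A
  shift_mulA shift_mul1l shift_mul1r shift_mulDl shift_mulDr shift_oner_neq0.

Lemma shiftMonM t u i j :
  shiftMon t i * shiftMon u j = shiftMon (t * shiftp i u) (i + j).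
Proof. exact: shift_mul_mon. Qed.

Lemma shift_scaleE c (a : A) : shift_scale c a = shiftMon c%:P 0 * a.
Proof.
elim/shift_ind: a => [|t i|a b IHa IHb].
- by rewrite mulr0 /shift_scale msupp0 big_seq_fset0.
- rewrite shiftMonM shiftp0 add0r /shift_scale.
  apply: (msum_monE (F := fun i p => shiftMon (c%:P * p) i)) => j.
  by rewrite mulr0 shiftMon0.
rewrite mulrDr -IHa -IHb.
apply: (msumD (F := fun i p => shiftMon (c%:P * p) i)) => [j|j p q].
  by rewrite mulr0 shiftMon0.
by rewrite mulrDr shiftMonD.
Qed.

Lemma shift_scaleA c d (a : A) :
  shift_scale c (shift_scale d a) = shift_scale (c * d) a.
Proof. by rewrite !shift_scaleE mulrA shiftMonM shiftp0 -rmorphM. Qed.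

Lemma shift_scale1 : left_id 1 shift_scale.
Proof. by move=> a; rewrite shift_scaleE; apply: mul1r. Qed.

Lemma shift_scaleDr : right_distributive shift_scale +%R.
Proof. by move=> c a b; rewrite !shift_scaleE mulrDr. Qed.

Lemma shift_scaleDl (a : A) : {morph shift_scale^~ a : c d / c + d}.
Proof. by move=> c d; rewrite !shift_scaleE -mulrDl -shiftMonD -rmorphD. Qed.

HB.instance Definition _ := GRing.Zmodule_isLmodule.Build K A
  shift_scaleA shift_scale1 shift_scaleDr shift_scaleDl.

Lemma shift_scaleAl (c : K) (a b : A) : c *: (a * b) = (c *: a) * b.
Proof. by rewrite /GRing.scale /= !shift_scaleE mulrA. Qed.

HB.instance Definition _ := GRing.Lmodule_isLalgebra.Build K A shift_scaleAl.

Lemma shift_scaleAr (c : K) (a b : A) : c *: (a * b) = a * (c *: b).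
Proof.
rewrite /GRing.scale /= !shift_scaleE !mulrA; congr (_ * _).
elim/shift_ind: a => [|t i|a a' IHa IHa']; first by rewrite mul0r mulr0.
  by rewrite !shiftMonM shiftp0 shiftpC add0r addr0 mulrC.
by rewrite mulrDl mulrDr IHa IHa'.
Qed.

HB.instance Definition _ := GRing.Lalgebra_isAlgebra.Build K A shift_scaleAr.

End ShiftAlgebra.

Section Operators.

Variable K : fieldType.
Local Notation A := (shiftAlg K).

Definition opx : A := shiftMon 'X 0.
Definition opSpow (j : int) : A := shiftMon 1 j.
Definition opS : A := opSpow 1.
Definition opSinv : A := opSpow (-1).
Definition opD : A := opS - 1.
Definition opX : A := opx * opSinv.

Lemma opSxE : opS * opx = (opx + 1) * opS.
Proof.
rewrite /opS /opSpow /opx -[X in _ + X]/(shiftMon 1 0) -shiftMonD !shiftMonM.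
by rewrite /shiftp comp_polyX comp_polyC mulr1 mul1r addrC.
Qed.

Lemma opSpowD i j : opSpow (i + j) = opSpow i * opSpow j.
Proof. by rewrite shiftMonM shiftpC mulr1. Qed.

Lemma opSSinv : opS * opSinv = 1.
Proof. by rewrite -opSpowD subrr. Qed.

Lemma opSinvS : opSinv * opS = 1.
Proof. by rewrite -opSpowD addNr. Qed.

Lemma opx_horner (p : {poly K}) : horner_alg opx p = shiftMon p 0.
Proof.
elim/poly_ind: p => [|p c IHp]; first by rewrite rmorph0 shiftMon0.
rewrite rmorphD rmorphM /= IHp horner_algX horner_algC shiftMonM shiftp0 addr0.
rewrite shiftMonD; congr (_ + _).
by rewrite /GRing.scale /= shift_scaleE mulr1.
Qed.

(* every operator is \sum_j t_j(x) S^j, with uniquely determined t_j (malgP) *)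
Lemma shift_normal_form (a : A) :
  a = \sum_(j <- msupp a) horner_alg opx a@_j * opSpow j.
Proof.
rewrite {1}(shift_sum a); apply: eq_bigr => j _.
by rewrite opx_horner shiftMonM shiftp0 mulr1 add0r.
Qed.

(* membership in R = K[S, S^-1] = K[D, (D + 1)^-1], as S = D + 1 *)
Definition inR (g : A) : Prop :=
  exists c : {malg K[int]}, g = \sum_(j <- msupp c) c@_j *: opSpow j.

Definition bracket (a b : A) : A := a * b - b * a.

Definition sl2_triple (E H F : A) : Prop :=
  [/\ bracket H E = 2%:R * E, bracket H F = - (2%:R * F) & bracket E F = H].

Definition sl2_H0 (lam : K) : A := 2%:R * opX * opD - lam%:A.
Definition sl2_E0 (lam : K) : A := opX ^+ 2 * opD - lam *: opX.

End Operators.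

Arguments opx K : clear implicits.
Arguments opS K : clear implicits.
Arguments opSinv K : clear implicits.
Arguments opD K : clear implicits.
Arguments opX K : clear implicits.

(* Main.v *)
(* Since [D, X] = 1 and the centraliser of S in A is R (a polynomial with
   t(x + 1) = t(x) is constant in characteristic 0), the relation
   [D, H] = 2 D forces H = 2 X D + r with r in R.  Dividing r by D = S - 1
   absorbs it into a translation Y = X + g and a constant.  Then [D, E] = H
   determines E up to some c in R, and [H, c] = 2 c says that c D commutes
   with Y; as it also commutes with S it is central, that is a constant, and
   no nonzero constant is a multiple of D.  The automorphism sigma_g is the
   substitution x |-> x + g S, S |-> S. *)
From HB Require Import structures.
Require Import Defs.
From mathcomp Require Import all_boot all_order all_algebra.
From mathcomp Require Import finmap.
From mathcomp.multinomials Require Import monalg.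

Set Implicit Arguments.
Unset Strict Implicit.
Unset Printing Implicit Defensive.

Import GRing.Theory.
Local Open Scope ring_scope.

Section ShiftAlgebraTheory.

Variable K : fieldType.
Local Notation A := (shiftAlg K).
Implicit Types (a b c g : A) (t : {poly K}) (lam : K) (i j k : int).

(** * Coefficients of products, and the subalgebra R *)

Lemma mcoeff_shiftMonMl t i a k :
  (shiftMon t i * a)@_k = t * shiftp i a@_(k - i).
Proof.
elim/shift_ind: a => [|u j|a b IHa IHb].
- by rewrite mulr0 !mcoeff0 /shiftp comp_poly0 mulr0.
- rewrite shiftMonM !mcoeffU [j == _]eq_sym subr_eq addrC [k == _]eq_sym.
  by case: eqP; rewrite ?mulr1n // !mulr0n /shiftp comp_poly0 mulr0.
by rewrite mulrDr !mcoeffD IHa IHb shiftpD mulrDr.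
Qed.

Lemma mcoeff_shiftMonMr a t i k :
  (a * shiftMon t i)@_k = a@_(k - i) * shiftp (k - i) t.
Proof.
elim/shift_ind: a => [|u j|a b IHa IHb].
- by rewrite mul0r !mcoeff0 mul0r.
- rewrite shiftMonM !mcoeffU [j == _]eq_sym subr_eq [k == _]eq_sym.
  by case: eqP => [<-|_]; rewrite ?addrK ?mulr1n // !mulr0n mul0r.
by rewrite mulrDl !mcoeffD IHa IHb mulrDl.
Qed.

Lemma opXS : opX K * opS K = opx K.
Proof. by rewrite -mulrA opSinvS mulr1. Qed.

Lemma mcoeff_opSMl a k : (opS K * a)@_k = shiftp 1 a@_(k - 1).
Proof. by rewrite mcoeff_shiftMonMl mul1r. Qed.

Lemma mcoeff_opSMr a k : (a * opS K)@_k = a@_(k - 1).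
Proof. by rewrite mcoeff_shiftMonMr shiftpC mulr1. Qed.

Lemma mcoeff_opxMl a k : (opx K * a)@_k = 'X * a@_k.
Proof. by rewrite mcoeff_shiftMonMl subr0 shiftp0. Qed.

Lemma mcoeff_opxMr a k : (a * opx K)@_k = a@_k * ('X + k%:~R%:P).
Proof. by rewrite mcoeff_shiftMonMr subr0 /shiftp comp_polyX. Qed.

Lemma scale_shiftMon lam t i : lam *: shiftMon t i = shiftMon (lam%:P * t) i.
Proof. by rewrite /GRing.scale /= shift_scaleE shiftMonM shiftp0 add0r. Qed.

Lemma scale_shift1 lam : lam%:A = shiftMon lam%:P 0 :> A.
Proof. by rewrite scale_shiftMon mulr1. Qed.

Lemma mcoeff_laurent (c : {malg K[int]}) k :
  (\sum_(j <- msupp c) c@_j *: opSpow K j : A)@_k = (c@_k)%:P.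
Proof.
rewrite [in RHS](monalgE c) !raddf_sum /=.
apply: eq_bigr => j _; rewrite scale_shiftMon mulr1 !mcoeffU.
by case: eqP; rewrite ?mulr1n.
Qed.

(** A coefficientwise test, which can be compared with commutation relations. For the converse, the
    Laurent polynomial collects the constant terms of the coefficients. *)
Lemma inRP g : inR g <-> forall k, g@_k = ((g@_k)`_0)%:P.
Proof.
split=> [[c ->] k|gC]; first by rewrite mcoeff_laurent coefC.
pose c : {malg K[int]} := \sum_(j <- msupp g) << (g@_j)`_0 *g j >>.
exists c; apply/malgP => k; rewrite mcoeff_laurent gC; congr _%:P.
rewrite {1}(shift_sum g) /c !raddf_sum /= coef_sum. 
apply: eq_bigr => j _; rewrite !mcoeffU.
by case: eqP; rewrite ?mulr1n ?coef0.
Qed.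

Lemma mcoeff_far a : exists n : nat, a@_(n.+1%:Z) = 0 /\ a@_(- n.+1%:Z) = 0.
Proof.
(* The sum of the absolute values of the exponents bounds each of them, so [n + 1] and its opposite
   lie outside the support. *)
pose n := (\sum_(j <- msupp a) `|j|)%N.
have out j : `|j|%N = n.+1 -> a@_j = 0.
  move=> jn; apply: mcoeff_outdom; apply/negP => ja.
  have: (`|j| <= \sum_(i <- msupp a) `|i|)%N.
    by rewrite (bigD1_seq j) ?fset_uniq //= leq_addr.
  by rewrite jn ltnn.
by exists n; split; apply: out; rewrite ?abszN.
Qed.

(** The coefficient of [a D] at [k] is [a_(k-1) - a_k], which vanishes for [k != 0]. So the
    coefficients of [a] are constant along [k >= 0] and along [k < 0], and finite support makes both
    constants zero. *)
Lemma mulD_scalar a lam : a * opD K = lam%:A -> a = 0.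
Proof.
move=> aD.
have step k : a@_(k - 1) - a@_k = lam%:P *+ (0 == k).
  have: (a * opD K)@_k = lam%:P *+ (0 == k) by rewrite aD scale_shift1 mcoeffU.
  by rewrite mulrBr mulr1 mcoeffB mcoeff_opSMr.
have step0 k : k != 0 -> a@_(k - 1) = a@_k.
  by rewrite eq_sym => /negPf k0; apply/eqP; rewrite -subr_eq0 step k0.
have pos n : a@_(Posz n) = a@_0.
  by elim: n => // n <-; rewrite -step0 // -addn1 PoszD addrK.
have neg n : a@_(- n.+1%:Z) = a@_(-1).
  elim: n => // n <-; rewrite -[in RHS]step0 //.
  by rewrite -opprD -PoszD addn1.
have [n [an aNn]] := mcoeff_far a.
have a0 : a@_0 = 0 by rewrite -(pos n.+1).
have aN1 : a@_(-1) = 0 by rewrite -(neg n).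
apply/malgP => -[k|k]; first by rewrite pos a0 mcoeff0.
by rewrite NegzE neg aN1 mcoeff0.
Qed.

Lemma commS_pow a j : opS K * a = a * opS K ->
  opSpow K j * a = a * opSpow K j.
Proof.
move=> aS.
(* [S^-1 a = S^-1 (a S) S^-1 = S^-1 (S a) S^-1 = a S^-1]. *)
have aV : opSinv K * a = a * opSinv K.
  by rewrite -[LHS]mulr1 -(opSSinv K) mulrA -(mulrA (opSinv K)) -aS
             !mulrA opSinvS mul1r.
elim/int_ind: j => [|n IH|n IH]; first by rewrite mul1r mulr1.
  by rewrite -addn1 PoszD opSpowD -mulrA aS mulrA IH mulrA.
by rewrite -addn1 PoszD opprD opSpowD -mulrA aV mulrA IH mulrA.
Qed.

Lemma inR_commS g : inR g -> opS K * g = g * opS K.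
Proof.
move/inRP => gC; apply/malgP => k.
by rewrite mcoeff_opSMl mcoeff_opSMr gC shiftpC.
Qed.

(** * Leibniz rules and linearity of the bracket *)

Lemma bracketMl a b c : bracket (a * b) c = a * bracket b c + bracket a c * b.
Proof. by rewrite /bracket mulrBr mulrBl !mulrA addrA subrK. Qed.

Lemma bracketN a b : bracket a b = - bracket b a.
Proof. by rewrite /bracket opprB. Qed.

Lemma bracketMr a b c : bracket a (b * c) = bracket a b * c + b * bracket a c.
Proof. by rewrite /bracket mulrBl mulrBr !mulrA addrA subrK. Qed.

Lemma bracketDr a b c : bracket a (b + c) = bracket a b + bracket a c.
Proof. by rewrite /bracket mulrDl mulrDr opprD addrACA. Qed.

Lemma bracketNr a b : bracket a (- b) = - bracket a b.
Proof. by rewrite /bracket mulrN mulNr -opprD. Qed.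

Lemma bracketBr a b c : bracket a (b - c) = bracket a b - bracket a c.
Proof. by rewrite bracketDr bracketNr. Qed.

Lemma bracketDl a b c : bracket (a + b) c = bracket a c + bracket b c.
Proof. by rewrite /bracket mulrDl mulrDr opprD addrACA. Qed.

Lemma bracketNl a b : bracket (- a) b = - bracket a b.
Proof. by rewrite /bracket mulrN mulNr -opprD. Qed.

Lemma bracketBl a b c : bracket (a - b) c = bracket a c - bracket b c.
Proof. by rewrite bracketDl bracketNl. Qed.

Lemma bracketZl lam a b : bracket (lam *: a) b = lam *: bracket a b.
Proof. by rewrite /bracket -scalerAl -scalerAr scalerBr. Qed.

Lemma bracketZr lam a b : bracket a (lam *: b) = lam *: bracket a b.
Proof. by rewrite /bracket -scalerAl -scalerAr scalerBr. Qed.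

Lemma bracket1l a : bracket 1 a = 0.
Proof. by rewrite /bracket mul1r mulr1 subrr. Qed.

Lemma bracketaa a : bracket a a = 0.
Proof. exact: subrr. Qed.

Lemma bracket0P a b : bracket a b = 0 <-> a * b = b * a.
Proof. by split=> [/subr0_eq //|ab]; rewrite /bracket ab subrr. Qed.

(** * The relation [[D, X] = 1] and its translates by R *)

Lemma bracketD1 a : bracket (opD K) a = bracket (opS K) a.
Proof. by rewrite bracketBl bracket1l subr0. Qed.

(** From [S x = (x + 1) S] one gets [[S, x] = S]; as [S] commutes with [S^-1], [[S, x S^-1] = S
    S^-1]. *)
Lemma bracketDX : bracket (opD K) (opX K) = 1.
Proof.
have Sx : bracket (opS K) (opx K) = opS K.
  by rewrite /bracket opSxE mulrDl mul1r addrAC subrr add0r.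
rewrite bracketD1 bracketMr Sx [bracket _ (opSinv K)](bracket0P _ _).2.
  by rewrite mulr0 addr0 opSSinv.
by rewrite opSSinv opSinvS.
Qed.

Lemma bracketDXg g : inR g -> bracket (opD K) (opX K + g) = 1.
Proof.
move=> /inR_commS gS; rewrite bracketDr bracketDX bracketD1.
by rewrite (bracket0P _ _).2 ?addr0.
Qed.

Lemma two_scale a : 2%:R * a = 2%:R *: a.
Proof. by rewrite scaler_nat mulr_natl. Qed.

(** * The triple attached to any [Y] with [[D, Y] = 1] *)

Definition sl2_H (Y : A) lam : A := 2%:R * Y * opD K - lam%:A.
Definition sl2_E (Y : A) lam : A := Y ^+ 2 * opD K - lam *: Y.

Section WeylPair.

Variables (Y : A) (lam : K).
Hypothesis DY : bracket (opD K) Y = 1.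

Lemma sl2_HE : sl2_H Y lam = 2%:R *: (Y * opD K) - lam%:A.
Proof. by rewrite /sl2_H -mulrA two_scale. Qed.

(** The factored form suits the Leibniz rule, since the second factor differs from [Y D] by a
    scalar. *)
Lemma sl2_EE : sl2_E Y lam = Y * (Y * opD K - lam%:A).
Proof. by rewrite /sl2_E expr2 -mulrA [RHS]mulrBr -scalerAr mulr1. Qed.

Lemma bracket_sl2_H a :
  bracket (sl2_H Y lam) a =
    2%:R *: (Y * bracket (opD K) a + bracket Y a * opD K).
Proof.
by rewrite sl2_HE bracketBl !bracketZl bracket1l scaler0 subr0 bracketMl.
Qed.

(** Since [[D, Y D] = D], the factored form of [E] gives [(Y D - lam) + Y D]. *)
Lemma bracketD_E : bracket (opD K) (sl2_E Y lam) = sl2_H Y lam.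
Proof.
rewrite sl2_EE bracketMr bracketBr bracketMr DY !mul1r bracketaa mulr0 addr0.
rewrite bracketZr /bracket mulr1 mul1r subrr scaler0 subr0 sl2_HE.
by rewrite scaler_nat mulr2n addrAC.
Qed.

Lemma bracketH_D : bracket (sl2_H Y lam) (opD K) = - (2%:R * opD K).
Proof.
rewrite bracket_sl2_H bracketaa mulr0 add0r bracketN DY mulN1r.
by rewrite scalerN two_scale.
Qed.

(** By [bracket_sl2_H] the left side is [2 (Y H + [Y, E] D)]. Here [[Y, E] = Y [Y, Y D] = - Y^2], so
    the sum is [Y (2 Y D - lam) - Y^2 D = E]. *)
Lemma bracketH_E : bracket (sl2_H Y lam) (sl2_E Y lam) = 2%:R * sl2_E Y lam.
Proof.
rewrite bracket_sl2_H bracketD_E two_scale; congr (_ *: _).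
rewrite sl2_EE sl2_HE bracketMr bracketaa mul0r add0r bracketBr bracketZr.
rewrite [bracket Y 1]bracketN bracket1l oppr0 scaler0 subr0 bracketMr bracketaa.
rewrite mul0r add0r [bracket Y _]bracketN DY mulrN mulr1 mulrN mulNr.
rewrite -mulrA -mulrBr scaler_nat mulr2n; congr (_ * _).
by rewrite addrAC addrK.
Qed.

Lemma sl2_triple_Weyl : sl2_triple (sl2_E Y lam) (sl2_H Y lam) (- opD K).
Proof.
split; first exact: bracketH_E.
  by rewrite bracketNr bracketH_D mulrN.
by rewrite bracketNr -bracketN bracketD_E.
Qed.

End WeylPair.

(** * Substitution for [x] and the automorphisms [sigma g] *)

Definition subst_x (z : A) a : A :=
  \sum_(j <- msupp a) horner_alg z a@_j * opSpow K j.

Section Substitution.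

Variable z : A.
Hypothesis Sz : forall i, opSpow K i * z = (z + (i%:~R)%:A) * opSpow K i.

Lemma subst_x_mon t i : subst_x z (shiftMon t i) = horner_alg z t * opSpow K i.
Proof.
apply: (msum_monE (F := fun j p => horner_alg z p * opSpow K j)) => j.
by rewrite rmorph0 mul0r.
Qed.

Lemma subst_x0 : subst_x z 0 = 0.
Proof. by rewrite /subst_x msupp0 big_seq_fset0. Qed.

Lemma subst_xD : {morph subst_x z : a b / a + b}.
Proof.
move=> a b; apply: (msumD (F := fun j p => horner_alg z p * opSpow K j)).
  by move=> j; rewrite rmorph0 mul0r.
by move=> j p q; rewrite rmorphD mulrDl.
Qed.

(** Extends the relation [Sz] from [z] to polynomials in [z]; this is exactly what multiplicativity
    of the substitution needs on monomials. *)
Lemma opSpow_horner_alg i t :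
  opSpow K i * horner_alg z t = horner_alg z (shiftp i t) * opSpow K i.
Proof.
elim/poly_ind: t => [|t c IH].
  by rewrite /shiftp comp_poly0 rmorph0 mulr0 mul0r.
rewrite shiftpD shiftpM shiftpC /shiftp comp_polyX -/(shiftp i t).
rewrite !rmorphD !rmorphM /= rmorphD /= !horner_algX !horner_algC mulrDr.
rewrite mulrA IH -mulrA Sz mulrA.
by rewrite -scalerAr mulr1 mulrDl -scalerAl mul1r.
Qed.

Lemma subst_xM : {morph subst_x z : a b / a * b}.
Proof.
move=> a b; elim/shift_ind: a => [|t i|a a' IHa IHa'].
- by rewrite mul0r subst_x0 mul0r.
- elim/shift_ind: b => [|u j|b b' IHb IHb'].
  + by rewrite mulr0 subst_x0 mulr0.
  + rewrite shiftMonM !subst_x_mon rmorphM /= opSpowD.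
    rewrite -[LHS]mulrA -[RHS]mulrA; congr (_ * _).
    by rewrite [RHS]mulrA opSpow_horner_alg [LHS]mulrA.
  by rewrite mulrDr !subst_xD IHb IHb' mulrDr.
by rewrite mulrDl !subst_xD IHa IHa' mulrDl.
Qed.

Lemma subst_x_opSpow j : subst_x z (opSpow K j) = opSpow K j.
Proof. by rewrite subst_x_mon rmorph1 mul1r. Qed.

Lemma subst_x_opx : subst_x z (opx K) = z.
Proof. by rewrite subst_x_mon horner_algX mulr1. Qed.

Lemma subst_xZ lam : {morph subst_x z : a / lam *: a}.
Proof.
move=> a; rewrite -[in LHS](mul1r a) scalerAl subst_xM scale_shift1.
by rewrite subst_x_mon horner_algC mulr1 -scalerAl mul1r.
Qed.

End Substitution.

(* The test makes [sigma_fun g] an algebra morphism for every [g]. *)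
Definition sigma_opx g : A :=
  opx K + (if opS K * g == g * opS K then g else 0) * opS K.

Definition sigma_fun g : A -> A := subst_x (sigma_opx g).

(** [x] moves past [S^i] by the shift [i], while the added term commutes with every [S^i], whichever
    branch the test selects. *)
Lemma sigma_relation g i :
  opSpow K i * sigma_opx g = (sigma_opx g + (i%:~R)%:A) * opSpow K i.
Proof.
rewrite /sigma_opx; set h := if _ then _ else _.
have hS : opS K * h = h * opS K.
  by rewrite /h; case: eqP; rewrite ?mulr0 ?mul0r.
have x_i : opSpow K i * opx K = (opx K + (i%:~R)%:A) * opSpow K i.
  rewrite scale_shift1 -shiftMonD !shiftMonM shiftp0 mulr1 addr0 add0r.
  by rewrite mul1r /shiftp comp_polyX.
rewrite mulrDr x_i addrAC [RHS]mulrDl; congr (_ + _).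
by apply: commrM; [apply: commS_pow | apply: commS_pow].
Qed.

Fact sigma_nmod_morphism g : nmod_morphism (sigma_fun g).
Proof. by split; [apply: subst_x0 | apply: subst_xD]. Qed.

Fact sigma_monoid_morphism g : monoid_morphism (sigma_fun g).
Proof.
by split; [apply: (subst_x_opSpow _ 0) | apply: subst_xM (@sigma_relation g)].
Qed.

Fact sigma_scalable g : scalable (sigma_fun g).
Proof. by move=> lam; apply: (subst_xZ (@sigma_relation g)). Qed.

HB.instance Definition _ g :=
  GRing.isNmodMorphism.Build A A (sigma_fun g) (sigma_nmod_morphism g).
HB.instance Definition _ g :=
  GRing.isMonoidMorphism.Build A A (sigma_fun g) (sigma_monoid_morphism g).
HB.instance Definition _ g :=
  GRing.isScalable.Build K A A *:%R (sigma_fun g) (@sigma_scalable g).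

Definition sigma g : {lrmorphism A -> A} := sigma_fun g.

Lemma sigma_opSpow g j : sigma g (opSpow K j) = opSpow K j.
Proof. exact: subst_x_opSpow. Qed.

Lemma sigma_opD g : sigma g (opD K) = opD K.
Proof. by rewrite rmorphB rmorph1 /= sigma_opSpow. Qed.

(** Membership in R makes the test succeed, and [(x + g S) S^-1 = X + g]. *)
Lemma sigma_opX g : inR g -> sigma g (opX K) = opX K + g.
Proof.
move/inR_commS => gS; rewrite rmorphM /= sigma_opSpow.
rewrite [sigma g _]subst_x_opx /sigma_opx gS eqxx.
by rewrite mulrDl -mulrA opSSinv mulr1.
Qed.

Lemma sigma_inR g h : inR h -> sigma g h = h.
Proof.
case=> c ->; rewrite rmorph_sum /=; apply: eq_bigr => j _.
by rewrite linearZ /= sigma_opSpow.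
Qed.

(** [D] and [X] determine a unital morphism: [S = D + 1], the image of [S^-1] is the inverse of that
    of [S], and [x = X S]. The normal form then covers all of [A]. *)
Lemma lrmorph_DX_eq (f h : {lrmorphism A -> A}) :
  f (opD K) = h (opD K) -> f (opX K) = h (opX K) -> f =1 h.
Proof.
move=> fhD fhX.
have fhS : f (opS K) = h (opS K).
  rewrite -[opS K](subrK 1) -/(opD K) (rmorphD f) (rmorphD h).
  by rewrite !rmorph1 /= fhD.
have fhV : f (opSinv K) = h (opSinv K).
  rewrite -[LHS]mulr1 -(rmorph1 h) -(opSSinv K) (rmorphM h) /= -fhS mulrA.
  by rewrite -rmorphM opSinvS rmorph1 mul1r.
have fh_pow j : f (opSpow K j) = h (opSpow K j).
  elim/int_ind: j => [|n IH|n IH]; first by rewrite !rmorph1.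
    by rewrite -addn1 PoszD opSpowD !rmorphM /= IH fhS.
  by rewrite -addn1 PoszD opprD opSpowD !rmorphM /= IH fhV.
have fhx t : f (horner_alg (opx K) t) = h (horner_alg (opx K) t).
  elim/poly_ind: t => [|t c IH]; first by rewrite !rmorph0.
  rewrite !(rmorphD, rmorphM) /= horner_algX horner_algC IH -opXS.
  rewrite (rmorphM f (opX K)) (rmorphM h (opX K)) /=.
  by rewrite fhX fhS !linearZ /= !rmorph1.
move=> a; rewrite (shift_normal_form a) !rmorph_sum /=; apply: eq_bigr => j _.
by rewrite !rmorphM /= fhx fh_pow.
Qed.

Lemma sigma_H0 g lam : inR g -> sigma g (sl2_H0 lam) = sl2_H (opX K + g) lam.
Proof.
move=> gR; rewrite /sl2_H0 (raddfB (sigma g)) /= (rmorphM _ (2%:R * opX K)).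
rewrite (rmorphM _ 2%:R) rmorph_nat /= sigma_opD sigma_opX //.
by rewrite linearZ /= rmorph1.
Qed.

Lemma sigma_E0 g lam : inR g -> sigma g (sl2_E0 lam) = sl2_E (opX K + g) lam.
Proof.
move=> gR; rewrite /sl2_E0 (raddfB (sigma g)) /= (rmorphM _ (opX K ^+ 2)).
by rewrite (rmorphXn _ 2) /= sigma_opD linearZ /= sigma_opX.
Qed.

(** * Characteristic zero: the centraliser of [S] and the scalars *)

Section Char0.

Hypothesis charK : [pchar K] =i pred0.

(** [t - t(0)] vanishes at every natural number. These are pairwise distinct in characteristic zero,
    so there are more roots than the degree allows. *)
Lemma shiftp1_const t : shiftp 1 t = t -> t = (t`_0)%:P.
Proof.
move=> t1.
have tn n : shiftp n%:Z t = t.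
  elim: n => [|n IH]; first exact: shiftp0.
  by rewrite -addn1 PoszD -shiftp_shift t1 IH.
suff /eqP : t - t.[0]%:P = 0.
  by rewrite subr_eq0 => /eqP ->; rewrite coefC.
apply: (@roots_geq_poly_eq0 _ _ [seq n%:R | n <- iota 0 (size (t - t.[0]%:P))]).
- apply/allP => _ /mapP[n _ ->]; rewrite /root hornerD hornerN hornerC.
  by rewrite subr_eq0 -[in eqbRHS](tn n) horner_comp !hornerE.
- rewrite map_inj_uniq ?iota_uniq // => m n /eqP.
  wlog le_nm : m n / (n <= m)%N.
    by case/orP: (leq_total n m) => le W /eqP E;
      [|symmetry]; apply: W; rewrite ?E.
  rewrite -subr_eq0 -natrB // (pcharf0P K).1 // subn_eq0 => le_mn.
  by apply/eqP; rewrite eqn_leq le_mn.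
by rewrite size_map size_iota.
Qed.

(** Comparing coefficients at [k + 1] shows that each [g_k] is invariant under [x |-> x + 1], hence
    constant. *)
Lemma commS_inR g : opS K * g = g * opS K -> inR g.
Proof.
move=> gS; apply/inRP => k; apply: shiftp1_const.
by rewrite -[in LHS](addrK 1 k) -mcoeff_opSMl gS mcoeff_opSMr addrK.
Qed.

(** Commuting with [X] and [S] implies commuting with [x = X S]. At exponent [k] this reads
    [x a_k = a_k (x + k)], so [k a_k = 0] and only [a_0] survives. *)
Lemma center_scalar a : inR a -> bracket (opX K) a = 0 ->
  exists lam, a = lam%:A.
Proof.
move=> aR /bracket0P aX; have aC := (inRP a).1 aR.
have ax : opx K * a = a * opx K.
  by rewrite -opXS; apply/esym/commrM; [apply/esym | apply/esym/inR_commS].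
exists (a@_0)`_0; rewrite scale_shift1.
apply/malgP => k; rewrite mcoeffU; case: eqP => [<-|/eqP k0]; first exact: aC.
have: a@_k * k%:~R%:P = 0.
  apply: (addrI (a@_k * 'X)); rewrite -mulrDr -mcoeff_opxMr -ax mcoeff_opxMl.
  by rewrite addr0 mulrC.
move/eqP; rewrite mulf_eq0 polyC_eq0 => /orP[/eqP -> //|].
case: k k0 => n n0; rewrite ?NegzE ?mulrNz ?oppr_eq0 -pmulrn (pcharf0P K).1 //.
by move/eqP=> n0'; rewrite n0' in n0.
Qed.

Lemma two_neq0 : 2%:R != 0 :> K.
Proof. by rewrite (pcharf0P K).1. Qed.

(** * Closure of R, via the centraliser of [S], and division by [D] *)

Lemma inR0 : inR (0 : A).
Proof. by apply: commS_inR; rewrite mulr0 mul0r. Qed.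

Lemma inRD a b : inR a -> inR b -> inR (a + b).
Proof.
move=> /inR_commS aS /inR_commS bS; apply: commS_inR.
by rewrite mulrDl mulrDr aS bS.
Qed.

Lemma inRM a b : inR a -> inR b -> inR (a * b).
Proof.
move=> /inR_commS aS /inR_commS bS; apply: commS_inR.
by rewrite mulrA aS -mulrA bS mulrA.
Qed.

Lemma inRZ lam a : inR a -> inR (lam *: a).
Proof.
by move=> /inR_commS aS; apply: commS_inR; rewrite -scalerAl -scalerAr aS.
Qed.

Lemma inR_opSpow j : inR (opSpow K j).
Proof. by apply: commS_inR; rewrite -!opSpowD addrC. Qed.

Definition divD_spec a : Prop := exists lam g, inR g /\ a = g * opD K + lam%:A.

(** If [S^j = h D + l] and [a = g D + m], then [S^j a = S^j g D + m S^j = (S^j g + m h) D + m l]. *)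
Lemma divD_inv j a : divD_spec (opSpow K j) -> divD_spec a -> inR a ->
  divD_spec (opSpow K j * a).
Proof.
move=> [l [h [hR hE]]] [m [g [gR gE]]] aR.
exists (m * l), (opSpow K j * g + m *: h); split.
  by apply: inRD; [apply: inRM => //; apply: inR_opSpow | apply: inRZ].
rewrite [in LHS]gE mulrDr mulrA -scalerAr mulr1 [in X in _ + X]hE.
by rewrite scalerDr scalerA mulrDl -scalerAl addrA.
Qed.

Lemma inR_comm g a : inR g -> opS K * a = a * opS K -> g * a = a * g.
Proof.
move=> [c ->] aS; rewrite mulr_suml mulr_sumr; apply: eq_bigr => j _.
by rewrite -scalerAl -scalerAr commS_pow.
Qed.

(* Value and difference quotient of an element of [R] at [S = 1]. *)
Lemma inR_divD a : inR a -> divD_spec a.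
Proof.
have S1 : divD_spec (opSpow K 1).
  exists 1, 1; split; first exact: (inR_opSpow 0).
  by rewrite mul1r scale1r subrK.
have SN1 : divD_spec (opSpow K (-1)).
  exists 1, (- opSpow K (-1)); split.
    by rewrite -scaleN1r; apply/inRZ/inR_opSpow.
  by rewrite mulNr mulrBr opSinvS mulr1 opprB scale1r subrK.
have powP j : divD_spec (opSpow K j).
  elim/int_ind: j => [|n IH|n IH].
  - by exists 1, 0; rewrite mul0r add0r scale1r; split=> //; apply: inR0.
  - rewrite -addn1 PoszD addrC opSpowD.
    by apply: divD_inv => //; apply: inR_opSpow.
  rewrite -addn1 PoszD opprD addrC opSpowD.
  by apply: divD_inv => //; apply: inR_opSpow.
case=> c ->; elim/big_ind: _ => [|u v [l [g [gR ->]]] [m [h [hR ->]]]|j _].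
- by exists 0, 0; rewrite mul0r add0r scale0r; split=> //; apply: inR0.
- exists (l + m), (g + h); split; first exact: inRD.
  by rewrite mulrDl scalerDl addrACA.
have [l [g [gR ->]]] := powP j.
exists (c@_j * l), (c@_j *: g); split; first exact: inRZ.
by rewrite scalerDr scalerA scalerAl.
Qed.

(** * Uniqueness of the parameters and the classification *)

Lemma sl2_HD g lam :
  sl2_H (opX K + g) lam = sl2_H (opX K) 0 + (2%:R *: (g * opD K) - lam%:A).
Proof. by rewrite !sl2_HE scale0r subr0 mulrDl scalerDr addrA. Qed.

(** The pair can be read off [H]: the difference of two expressions makes [2 (g - h) D] a scalar, so
    [mulD_scalar] gives [g = h], and then the scalars agree. Both uniqueness claims rest on this. *)
Lemma sl2_H_inj g h lam mu :
  sl2_H (opX K + g) lam = sl2_H (opX K + h) mu -> g = h /\ lam = mu.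
Proof.
rewrite !sl2_HD => /addrI E.
have gh : (2%:R *: (g - h)) * opD K = (lam - mu)%:A.
  rewrite -scalerAl mulrBl scalerBr scalerBl.
  rewrite -[X in X - _](subrK lam%:A) E.
  by rewrite addrAC [X in X + _]addrAC subrr add0r addrC.
have /eqP := mulD_scalar gh.
rewrite scaler_eq0 (negPf two_neq0) subr_eq0 => /eqP gh'; split=> //.
move: gh; rewrite gh' subrr scaler0 mul0r => /esym/eqP.
by rewrite scaler_eq0 oner_eq0 orbF subr_eq0 => /eqP.
Qed.

Lemma sl2_triple_normal E H : sl2_triple E H (- opD K) ->
  exists lam g,
    [/\ inR g, H = sl2_H (opX K + g) lam & E = sl2_E (opX K + g) lam].
Proof.
move=> [HE HF EF].
have DH : bracket (opD K) H = 2%:R *: opD K.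
  by move: HF; rewrite bracketNr -bracketN => ->; rewrite mulrN opprK two_scale.
have DE : bracket (opD K) E = H.
  by move: EF; rewrite bracketNr -bracketN.
have rR : inR (H - sl2_H (opX K) 0).
  apply/commS_inR/bracket0P; rewrite -bracketD1 bracketBr DH.
  rewrite [bracket _ (sl2_H _ _)]bracketN bracketH_D ?bracketDX //.
  by rewrite opprK two_scale subrr.
have [lam [g [gR rE]]] := inR_divD rR.
(* Here [H = 2 X D + g D + lam]. Matching it with [2 Y D - lam'] requires the translation [g / 2]
   and [lam' = - lam]. *)
have hR : inR (2%:R^-1 *: g) by apply: inRZ.
exists (- lam), (2%:R^-1 *: g).
have HEq : H = sl2_H (opX K + 2%:R^-1 *: g) (- lam).
  move/eqP: rE; rewrite subr_eq => /eqP ->.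
  rewrite sl2_HD scalerAl scalerA (divff two_neq0) scale1r.
  by rewrite scaleNr opprK addrC.
have DY := bracketDXg hR.
split=> //; set Y := opX K + _ in HEq DY *.
(* The defect of [E] from the expected formula; both have the same bracket with [D], so [c] lies in
   R. *)
pose c := E - sl2_E Y (- lam).
have cS : opS K * c = c * opS K.
  by apply/bracket0P; rewrite -bracketD1 bracketBr DE bracketD_E // -HEq subrr.
have cR := commS_inR cS.
have Hc : bracket H c = 2%:R *: c.
  by rewrite bracketBr HE {1}HEq bracketH_E // !two_scale -scalerBr.
(* As [[D, c] = 0], the formula for [[H, c]] reduces to [2 [Y, c] D], which must equal [2 c]. *)
have cY : bracket Y c * opD K = c.
  apply: (scalerI two_neq0); rewrite -Hc HEq bracket_sl2_H bracketD1.
  by rewrite ((bracket0P (opS K) c).2 cS) mulr0 add0r.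
(* [[Y, c D] = [Y, c] D + c [Y, D] = c - c]. *)
have YcD : bracket Y (c * opD K) = 0.
  by rewrite bracketMr cY [bracket Y _]bracketN DY mulrN mulr1 subrr.
have cDR : inR (c * opD K).
  by apply: inRM => //; apply/commS_inR/bracket0P; rewrite -bracketD1 bracketaa.
(* [X] and [Y] differ by an element of R, which commutes with [c D]. *)
have XcD : bracket (opX K) (c * opD K) = 0.
  have -> : opX K = Y - 2%:R^-1 *: g by rewrite addrK.
  rewrite bracketBl YcD sub0r; apply/eqP; rewrite oppr_eq0; apply/eqP/bracket0P.
  exact/inR_comm/inR_commS.
have [mu ck] : exists mu : K, c * opD K = mu%:A.
  exact: center_scalar.
(* [c D] is a scalar, so [mulD_scalar] forces [c = 0]. *)
by apply/eqP; rewrite -subr_eq0; apply/eqP/(mulD_scalar ck).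
Qed.

(** It suffices to check the composite on [D] and [X]; there [X + g] goes to [(X - g) + g], since
    [g] is fixed. *)
Lemma sigmaK g : inR g -> cancel (sigma g) (sigma (- g)).
Proof.
move=> gR; have NgR : inR (- g) by rewrite -scaleN1r; apply: inRZ.
have /= := @lrmorph_DX_eq (sigma (- g) \o sigma g) idfun.
apply; first by rewrite /= !sigma_opD.
by rewrite /= sigma_opX // rmorphD /= sigma_opX // sigma_inR // addrNK.
Qed.

End Char0.
End ShiftAlgebraTheory.

Theorem theorem2p4 (K : fieldType) (charK : [pchar K] =i pred0) :
  (forall E H : shiftAlg K,
     sl2_triple E H (- opD K) <->
     exists! p : K * shiftAlg K,
       let: (lam, g) := p in
       let Y := opX K + g in
       [/\ inR g,
           H = 2%:R * Y * opD K - lam%:A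
         & E = Y ^+ 2 * opD K - lam *: Y])
  /\
  exists sigma : shiftAlg K -> {lrmorphism shiftAlg K -> shiftAlg K},
    (forall g : shiftAlg K, inR g ->
       [/\ sigma g (opD K) = opD K,
           sigma g (opX K) = opX K + g,
           (forall f : {lrmorphism shiftAlg K -> shiftAlg K},
              f (opD K) = opD K -> f (opX K) = opX K + g -> f =1 sigma g),
           cancel (sigma g) (sigma (- g))
         & cancel (sigma (- g)) (sigma g)])
    /\
    (forall E H F : shiftAlg K, sl2_triple E H F -> F = - opD K ->
       exists! p : shiftAlg K * K,
         let: (g, lam) := p in
         inR g /\
         (E, H, F) = (sigma g (sl2_E0 lam), sigma g (sl2_H0 lam), - opD K)).
Proof.
split=> [E H|].
  split=> [/(sl2_triple_normal charK) [lam [g [gR HE EE]]]|].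
    exists (lam, g); split=> // -[mu h] [hR HE' _].
    by move: HE'; rewrite HE => /(sl2_H_inj charK) [-> ->].
  case=> -[lam g] [[gR -> ->] _].
  exact: sl2_triple_Weyl (bracketDXg gR).
exists (@sigma K); split=> [g gR|E H F EHF FE].
  have NgR : inR (- g) by rewrite -scaleN1r; apply: inRZ.
  split.
  - exact: sigma_opD.
  - exact: sigma_opX.
  - by move=> f fD fX; apply: lrmorph_DX_eq; rewrite ?sigma_opD ?sigma_opX.
  - exact: sigmaK.
  (* The other cancellation is [sigmaK] at [- g], with [g] read as [- (- g)]. *)
  by rewrite -[in X in cancel _ X](opprK g); apply: sigmaK.
rewrite {}FE in EHF *.
have [lam [g [gR HE EE]]] := sl2_triple_normal charK EHF.
exists (g, lam); split=> [|[h mu] [hR [_ HE']]].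
  by rewrite sigma_E0 // sigma_H0 // HE EE.
by move: HE'; rewrite sigma_H0 // HE => /(sl2_H_inj charK) [-> ->].
Qed.
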